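(* Let $n > m \ge 2$ be integers, let $H$ be a maximal clique in the Johnson graph $G = J_n(m,m-1)$, and let $S = \bigcap_{v\in V(H)}\nu(v)$ be the intersection of the label sets of the nodes of $H$. Then $|S| \in \{0,\, m-1\}$.
   Context: $[n]=\{1,2,\ldots,n\}$ and $\binom{[n]}{m}$ is the collection of all $m$-element subsets of $[n]$. The Johnson graph $J_n(m,m-1)$ is the simple undirected graph with $\binom{n}{m}$ nodes, each node $v$ labelled by a unique set $\nu(v)\in\binom{[n]}{m}$ (so $\nu$ is a bijection from nodes to $\binom{[n]}{m}$), in which distinct nodes $v_i,v_j$ are adjacent if and only if $|\nu(v_i)\cap\nu(v_j)| = m-1$. A clique is a complete subgraph (identified with its vertex set $V(H)$); a clique is maximal if no strictly larger clique contains it. *)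

(* Defs.v *)
From mathcomp Require Import all_boot.

Set Implicit Arguments.
Unset Strict Implicit.
Unset Printing Implicit Defensive.

(* The ground set [n] = {1, ..., n} is rendered as 'I_n, and a
   simple graph on a finite node type V as its adjacency relation e : rel V. *)

Definition is_clique (V : finType) (e : rel V) (H : {set V}) : bool :=
  [forall v in H, forall w in H, (v != w) ==> e v w].

Definition maximal_clique (V : finType) (e : rel V) (H : {set V}) : bool :=
  maxset (is_clique e) H.

Definition johnson_labelling (n m : nat) (V : finType)
    (nu : V -> {set 'I_n}) : Prop :=
  injective nu /\ nu @: [set: V] = [set A : {set 'I_n} | #|A| == m].

Definition johnson_adj (n m : nat) (V : finType) (nu : V -> {set 'I_n}) :
    rel V :=
  fun v w => (v != w) && (#|nu v :&: nu w| == m - 1).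

Lemma johnson_adj_sym (n m : nat) (V : finType) (nu : V -> {set 'I_n}) :
  symmetric (johnson_adj m nu).
Proof. by move=> v w; rewrite /johnson_adj eq_sym setIC. Qed.

Lemma johnson_adj_irr (n m : nat) (V : finType) (nu : V -> {set 'I_n}) :
  irreflexive (johnson_adj m nu).
Proof. by move=> v; rewrite /johnson_adj eqxx. Qed.

(* Labellings exist: the m-subsets themselves may serve as nodes. *)
Lemma johnson_labelling_val (n m : nat) :
  johnson_labelling m (val : {A : {set 'I_n} | #|A| == m} -> {set 'I_n}).
Proof.
split; first exact: val_inj.
apply/setP=> A; rewrite inE; apply/imsetP/idP => [[v _ ->]|hA].
  exact: (valP v).
by exists (exist _ A hA).
Qed.

(* Main.v *)
Require Import Defs.
From mathcomp Require Import all_boot.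
From mathcomp Require Import zify.

(** Take two adjacent nodes of the maximal clique [H], with labels [A] and [B],
and let [I = A :&: B] (of size [m - 1]) and [U = A :|: B] (of size [m + 1]).

Either every label of [H] contains [I], and then the intersection of the labels
is [I] itself; or some label [C] does not.  The heart of the matter is
[meets_eq_of_not_sub_union]: an [m]-set that meets [A] and [B] in [m - 1]
elements each, and is not inside [U], meets both exactly in [I].  So [C] is
inside [U].  A label [D] sticking out of [U] would also stick out of
[A :|: C], hence [A :&: C = D :&: A = I] by the same lemma applied to both
pairs, and [C] would contain [I].  So all labels of [H] are inside the
[m + 1]-set [U].  Two [m]-subsets of an [m + 1]-set always meet in [m - 1]
elements, so by maximality [H] has every [m]-subset of [U] as a label; each
element of [U] is missed by one of these, and the intersection is empty.

The pair [A], [B] exists because [m < n]: a maximal clique is nonempty, and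
within any [m + 1]-set containing [A] there are other [m]-sets, so that one
node alone is never a maximal clique. *)

Set Implicit Arguments.
Unset Strict Implicit.
Unset Printing Implicit Defensive.

Section SetsMeetingInAllButOne.

Variables (T : finType) (k : nat).
Implicit Types A B C D U : {set T}.

Lemma card_setU_of_setI A B :
  #|A| = k.+1 -> #|B| = k.+1 -> #|A :&: B| = k -> #|A :|: B| = k.+2.
Proof. by move=> hA hB hI; have := cardsUI A B; lia. Qed.

Lemma card_setI_sub_succ U A B :
  #|U| = k.+2 -> #|A| = k.+1 -> #|B| = k.+1 -> A \subset U -> B \subset U ->
  A != B -> #|A :&: B| = k.
Proof.
move=> hU hA hB sAU sBU neqAB.
have leU : #|A :|: B| <= #|U| by rewrite subset_leq_card // subUset sAU.
have ltI : #|A :&: B| < #|A|.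
  rewrite ltn_neqAle subset_leq_card ?subsetIl // andbT.
  apply: contraNneq neqAB => eI.
  have sAB : A \subset B.
    by apply/setIidPl/eqP; rewrite eqEcard subsetIl eI leqnn.
  by rewrite eqEcard sAB hA hB leqnn.
by have := cardsUI A B; lia.
Qed.

(** Since [D] loses an element outside [A :|: B], the set [D :&: (A :|: B)] has
at most [k] elements, so its [k]-subsets [D :&: A] and [D :&: B] coincide with
it; their common value lies in [A :&: B], which has the same size. *)
Lemma meets_eq_of_not_sub_union A B D :
  #|D| = k.+1 -> #|A :&: B| = k -> #|D :&: A| = k -> #|D :&: B| = k ->
  ~~ (D \subset A :|: B) -> D :&: A = A :&: B.
Proof.
move=> hD hAB hDA hDB nsD.
have ltD : #|D :&: (A :|: B)| < #|D|.
  by rewrite proper_card // properE subsetIl subsetI subxx.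
have eqDA : D :&: A = D :&: (A :|: B).
  by apply/eqP; rewrite eqEcard setIS ?subsetUl //=; lia.
have eqDB : D :&: B = D :&: (A :|: B).
  by apply/eqP; rewrite eqEcard setIS ?subsetUr //=; lia.
apply/eqP; rewrite eqEcard hDA hAB leqnn andbT subsetI subsetIr /=.
by rewrite eqDA -eqDB subsetIr.
Qed.

Lemma sub_union_of_not_sub_meet A B C :
  #|C| = k.+1 -> #|A :&: B| = k -> #|C :&: A| = k -> #|C :&: B| = k ->
  ~~ (A :&: B \subset C) -> C \subset A :|: B.
Proof.
move=> hC hAB hCA hCB; apply: contraR => nsC.
by rewrite -(meets_eq_of_not_sub_union hC hAB hCA hCB nsC) subsetIl.
Qed.

(** Three labels that do not share [A :&: B] confine all their common
neighbours: outside [A :|: B], which contains [A :|: C], the set [D] would have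
to meet [A] both in [A :&: B] and in [A :&: C]. *)
Lemma sub_union_of_triangle A B C D :
  #|C| = k.+1 -> #|D| = k.+1 ->
  #|A :&: B| = k -> #|C :&: A| = k -> #|C :&: B| = k ->
  #|D :&: A| = k -> #|D :&: B| = k -> #|D :&: C| = k ->
  ~~ (A :&: B \subset C) -> D \subset A :|: B.
Proof.
move=> hC hD hAB hCA hCB hDA hDB hDC nsC.
have sCU := sub_union_of_not_sub_meet hC hAB hCA hCB nsC.
apply: contraR nsC => nsD.
have hAC : #|A :&: C| = k by rewrite setIC.
have nsDAC : ~~ (D \subset A :|: C).
  apply: contra nsD => /subset_trans; apply.
  by rewrite subUset subsetUl.
rewrite -(meets_eq_of_not_sub_union hD hAB hDA hDB nsD).
by rewrite (meets_eq_of_not_sub_union hD hAC hDA hDC nsDAC) subsetIr.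
Qed.

End SetsMeetingInAllButOne.

Lemma maximal_clique_mem (V : finType) (e : rel V) (H : {set V}) (w : V) :
  symmetric e -> maximal_clique e H ->
  (forall v, v \in H -> v != w -> e v w) -> w \in H.
Proof.
move=> sym_e /maxsetP [/forall_inP clH maxH] adj_w.
rewrite -(maxH (w |: H)) ?setU11 ?subsetUr //.
apply/forall_inP => u /setU1P [-> | uH]; apply/forall_inP => v /setU1P [-> | vH];
  apply/implyP => neq.
- by rewrite eqxx in neq.
- by rewrite sym_e adj_w // eq_sym.
- exact: adj_w.
- by have /forall_inP /(_ v vH) /implyP := clH u uH; apply.
Qed.

Lemma clique_adj (V : finType) (e : rel V) (H : {set V}) (v w : V) :
  is_clique e H -> v \in H -> w \in H -> v != w -> e v w.
Proof.
by move=> /forall_inP clH vH wH; have /forall_inP /(_ w wH) /implyP := clH v vH.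
Qed.

Section JohnsonCliques.

Variables (n k : nat) (V : finType) (nu : V -> {set 'I_n}).
Hypothesis nuP : johnson_labelling k.+1 nu.
Hypothesis ltkn : k.+1 < n.
Variable H : {set V}.
Hypothesis maxH : maximal_clique (johnson_adj k.+1 nu) H.

Let adj := johnson_adj k.+1 nu.

Lemma card_label v : #|nu v| = k.+1.
Proof.
by apply/eqP; have := imset_f nu (in_setT v); rewrite nuP.2 inE.
Qed.

Lemma label_exists (A : {set 'I_n}) : #|A| = k.+1 -> exists v, nu v = A.
Proof.
move=> hA; have : A \in nu @: [set: V] by rewrite nuP.2 inE hA.
by case/imsetP => v _ ->; exists v.
Qed.

Lemma card_meet v w : v \in H -> w \in H -> v != w -> #|nu v :&: nu w| = k.
Proof.
have /maxsetp clH := maxH.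
by move=> vH wH neq; have /andP [_ /eqP ->] := clique_adj clH vH wH neq; lia.
Qed.

Lemma adj_of_sub (U : {set 'I_n}) v w :
  #|U| = k.+2 -> nu v \subset U -> nu w \subset U -> v != w -> adj v w.
Proof.
move=> hU sv sw neq; rewrite /adj /johnson_adj neq /=.
rewrite (card_setI_sub_succ hU (card_label v) (card_label w) sv sw) ?subn1 //.
by rewrite (inj_eq nuP.1).
Qed.

(** Inside a [k.+2]-set any two distinct labels are adjacent, so maximality
forces [w] into [H]. *)
Lemma mem_of_common_superset (U : {set 'I_n}) w :
  #|U| = k.+2 -> (forall v, v \in H -> nu v \subset U) -> nu w \subset U ->
  w \in H.
Proof.
move=> hU sHU sw.
apply: (maximal_clique_mem _ maxH); first exact: johnson_adj_sym.
by move=> v vH neq; apply: (adj_of_sub hU) => //; apply: sHU.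
Qed.

Lemma maximal_clique_nonempty : exists v, v \in H.
Proof.
have /card_gt0P [A] : 0 < #|[set A : {set 'I_n} | #|A| == k.+1]|.
  by rewrite card_draws card_ord bin_gt0 ltnW.
rewrite inE => /eqP /label_exists [w _].
have [H0 | [v vH]] := set_0Vmem H; last by exists v.
exists w; apply: (maximal_clique_mem _ maxH); first exact: johnson_adj_sym.
by move=> v; rewrite H0 inE.
Qed.

Lemma maximal_clique_two : exists v w, [/\ v \in H, w \in H & v != w].
Proof.
have [v vH] := maximal_clique_nonempty.
have cv := card_label v.
have /card_gt0P [x xv] : 0 < #|nu v| by rewrite cv.
have /card_gt0P [y] : 0 < #|~: nu v|.
  by have := cardsC (nu v); rewrite card_ord cv; lia.
rewrite inE => yv.
have hU : #|y |: nu v| = k.+2 by rewrite cardsU1 yv cv.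
(* The label of [w] swaps [x] for [y] in that of [v]. *)
have [|w ew] := @label_exists ((y |: nu v) :\ x).
  by have := cardsD1 x (y |: nu v); rewrite hU !inE xv orbT; lia.
have neq : v != w.
  by apply: contraTneq xv => ->; rewrite ew !inE eqxx.
have [/subsetP sH1 | /subsetPn [u uH]] := boolP (H \subset [set v]).
  exists v, w; split=> //; apply: (mem_of_common_superset hU).
    by move=> u /sH1; rewrite inE => /eqP ->; rewrite subsetUr.
  by rewrite ew subsetDl.
by rewrite inE => neq_uv; exists u, v.
Qed.

(** When all labels of [H] lie in a [k.+2]-set [U], every [U :\ x] is a label
of [H], and it misses [x]. *)
Lemma bigcap_eq0_of_sub (U : {set 'I_n}) :
  #|U| = k.+2 -> (forall v, v \in H -> nu v \subset U) ->
  \bigcap_(v in H) nu v = set0.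
Proof.
move=> hU sHU; apply/eqP; rewrite -subset0; apply/subsetP => x /bigcapP xS.
have [v vH] := maximal_clique_nonempty.
have xU : x \in U by rewrite (subsetP (sHU v vH)) ?xS.
have [|w ew] := @label_exists (U :\ x).
  by have := cardsD1 x U; rewrite hU xU; lia.
have wH : w \in H by apply: (mem_of_common_superset hU) => //; rewrite ew subsetDl.
by have := xS w wH; rewrite ew !inE eqxx.
Qed.

Lemma card_bigcap_maximal_clique :
  #|\bigcap_(v in H) nu v| = 0 \/ #|\bigcap_(v in H) nu v| = k.
Proof.
have [a [b [aH bH neq_ab]]] := maximal_clique_two.
have hI := card_meet aH bH neq_ab.
have [sI | ] := boolP [forall c in H, nu a :&: nu b \subset nu c].
  right; rewrite -hI; congr #|pred_of_set _|; apply/eqP; rewrite eqEsubset.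
  rewrite subsetI !bigcap_inf //=.
  by apply/bigcapsP => c cH; apply: (forall_inP sI).
case/forall_inPn => c cH nsI; left.
have neq_ca : c != a by apply: contraNneq nsI => ->; rewrite subsetIl.
have neq_cb : c != b by apply: contraNneq nsI => ->; rewrite subsetIr.
have hCA := card_meet cH aH neq_ca; have hCB := card_meet cH bH neq_cb.
have hU := card_setU_of_setI (card_label a) (card_label b) hI.
rewrite (bigcap_eq0_of_sub hU) ?cards0 // => d dH.
have [-> | neq_da] := eqVneq d a; first exact: subsetUl.
have [-> | neq_db] := eqVneq d b; first exact: subsetUr.
have [-> | neq_dc] := eqVneq d c.
  exact: (sub_union_of_not_sub_meet (card_label c) hI hCA hCB nsI).
exact: (sub_union_of_triangle (card_label c) (card_label d) hI hCA hCB
  (card_meet dH aH neq_da) (card_meet dH bH neq_db) (card_meet dH cH neq_dc) nsI).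
Qed.

End JohnsonCliques.

Theorem theorem3p4 (n m : nat) (hm : 2 <= m) (hn : m < n)
    (V : finType) (nu : V -> {set 'I_n}) (hnu : johnson_labelling m nu)
    (H : {set V}) (hH : maximal_clique (johnson_adj m nu) H) :
  #|\bigcap_(v in H) nu v| = 0 \/ #|\bigcap_(v in H) nu v| = m - 1.
Proof.
case: m hm hn hnu hH => // k _ hn hnu hH.
by rewrite subn1; apply: (card_bigcap_maximal_clique hnu hn hH).
Qed.
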